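(* Let $k$ be a field with $\mathrm{char}(k)=0$. Let $A\subset B$ be two finitely generated integral $k$-algebras (i.e. finitely generated $k$-algebras which are integral domains, $A$ being a $k$-subalgebra of $B$). Let $\mathcal{F}$ be a family of $k$-derivations on $B$ such that $d(A)\subset A$ for any $d\in\mathcal{F}$. If $B$ is integral over $A$ and if $A$ has isolated non normal singular points, then $B^{\mathcal{F}}$ is integral over $A^{\mathcal{F}}$.
   Context: An ''integral $k$-algebra'' is a $k$-algebra that is an integral domain. For a family $\mathcal{F}$ of $k$-derivations on $B$ preserving $A$, set $A^{\mathcal{F}}=\bigcap_{d\in\mathcal{F}}\ker d_{|A}$ and $B^{\mathcal{F}}=\bigcap_{d\in\mathcal{F}}\ker d$. A closed point $x$ of $\mathrm{Spec}(A)$ (a maximal ideal of $A$) is a non normal singular point if the local ring $A_x$ is not integrally closed in its fraction field. The finitely generated $k$-algebra $A$ has isolated non normal singular points if the set of non normal singular points of $\mathrm{Spec}(A)$ is finite (possibly empty). *)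

(* Defs.v *)
From HB Require Import structures.
From mathcomp Require Import all_boot all_order all_algebra.
From mathcomp Require Import all_classical.

Set Implicit Arguments.
Unset Strict Implicit.
Unset Printing Implicit Defensive.

Import GRing.Theory.
Local Open Scope classical_set_scope.
Local Open Scope ring_scope.

(* Commutative k-algebras that are integral domains. The (unique) inverse of
   units carried by the structure is no restriction classically. *)
#[short(type="idomainAlgType")]
HB.structure Definition IntegralDomainAlgebra (k : nzRingType) :=
  { A of GRing.IntegralDomain A & GRing.ComUnitAlgebra k A }.

(* A = k[s] for some finite sequence s, where k[s] is the smallest
   subalgebra containing s. *)
Definition finitely_generated_algebra (k : nzRingType) (A : algType k) : Prop :=
  exists s : seq A, forall S : {pred A},
    GRing.subalg_closed S -> {subset s <= S} -> forall a, a \in S.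

(* k-linearity is part of the type of d. *)
Definition derivation (k : nzRingType) (B : algType k) (d : {linear B -> B}) :
    Prop :=
  forall x y : B, d (x * y) = d x * y + x * d y.

(* The library predicate [integralOver] is relative to a ring morphism; here
   the coefficients are taken in a subring S of R given as a set. *)
Definition integral_over (R : nzRingType) (S : set R) (x : R) : Prop :=
  exists p : {poly R}, [/\ p \is monic, forall i, S p`_i & root p x].

(* [idealr_closed] includes properness: 1 \notin m. *)
Definition maximal_ideal (A : comNzRingType) (m : {pred A}) : Prop :=
  idealr_closed m /\
  forall I : {pred A}, idealr_closed I -> {subset m <= I} -> {subset I <= m}.

(* For a domain A, the local ring A_m is the subring of fractions a / s with
   s \notin m inside Frac(A), which is also the fraction field of A_m. *)
Definition local_ring (A : idomainType) (m : {pred A}) : set {fraction A} :=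
  [set q | exists a s : A, s \notin m /\ q = tofrac a / tofrac s].

Definition integrally_closed (K : fieldType) (S : set K) : Prop :=
  forall q : K, integral_over S q -> S q.

Definition non_normal_point (A : idomainType) (m : {pred A}) : Prop :=
  maximal_ideal m /\ ~ integrally_closed (local_ring m).

Definition isolated_non_normal_points (A : idomainType) : Prop :=
  finite_set [set m : {pred A} | non_normal_point m].

Definition constants (k : nzRingType) (B : algType k)
    (F : set {linear B -> B}) : set B :=
  [set b | forall d, F d -> d b = 0].

(* A^F, seen inside B through the inclusion iota : A -> B. *)
Definition constants_sub (k : nzRingType) (A B : algType k)
    (iota : {lrmorphism A -> B}) (F : set {linear B -> B}) : set B :=
  range iota `&` constants F.

(* Main.v *)
(* Let [b] be killed by [F] and let [P] over [A] have minimal degree among the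
   nonzero polynomials vanishing at [b].  Comparing degrees in [d (P b) = 0]
   shows that the coefficients [q] of the monic polynomial [P / lead_coef P]
   are constants of [Frac A]; they are integral over [A], since that polynomial
   divides a monic polynomial over [A].  It is enough to find, for each [q], a
   nonconstant monic [Q] over [k] with [Q q] in [A]: then [Q q] is a constant of
   [A], so [q] is integral over the constants of [A].
   The conductor of [A] in [A[q]] is contained in no maximal ideal other than
   the finitely many non normal points [m].  The residue field of [m] is
   algebraic over [k], so some monic [Q] over [k] is a multiple, modulo [m], of
   the integral equation of [q]; a product of these works for all the [m]
   simultaneously, and by the Nullstellensatz one of its powers sends [q] into
   the conductor, hence into [A].
   The Nullstellensatz comes from Zorn's lemma (an ideal [P] maximal among those
   avoiding the powers of [f]) and from the descent of G-domains along
   [S <= S[x]], applied to [A / P]. *)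
Require Import Defs.
From HB Require Import structures.
From mathcomp Require Import all_boot all_order all_algebra.
From mathcomp Require Import all_classical.

Set Implicit Arguments.
Unset Strict Implicit.
Unset Printing Implicit Defensive.

Import GRing.Theory.
Local Open Scope classical_set_scope.
Local Open Scope ring_scope.

(** * Prime ideals and residue fields *)

(** A quotient ring carries no inverse operation, so units and inverses are chosen classically
    before the fraction field is formed. *)
Lemma domain_embeds_in_field (D : comNzRingType) :
  GRing.integral_domain_axiom D ->
  exists (E : fieldType) (j : {rmorphism D -> E}), injective j.
Proof.
move=> domD.
pose unit (x : D) := `[< exists y, y * x = 1 >].
pose inv (x : D) : D :=
  if pselect (exists y, y * x = 1) is left e then projT1 (cid e) else x.
have mulVx : {in unit, left_inverse 1 inv *%R}.
  move=> x; rewrite /inv unfold_in => /asboolP ex.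
  by case: pselect => // e; case: cid.
have unitPl (x y : D) : y * x = 1 -> unit x by move=> yx1; apply/asboolP; exists y.
have inv_out : {in [predC unit], inv =1 id}.
  move=> x; rewrite inE /inv unfold_in => /asboolP ex.
  by case: pselect.
pose mU := GRing.ComNzRing_hasMulInverse.Build D mulVx unitPl inv_out.
pose U : comUnitRingType := HB.pack D mU.
pose mI := GRing.ComUnitRing_isIntegral.Build U domD.
pose I : idomainType := HB.pack U mI.
exists {fraction I}, (@tofrac I : {rmorphism I -> {fraction I}}).
by move=> x y /eqP; rewrite tofrac_eq => /eqP.
Qed.

Lemma prime_ideal_residue_field (A : comNzRingType) (P : {pred A}) :
  idealr_closed P -> prime_idealr_closed P ->
  exists (E : fieldType) (pi : {rmorphism A -> E}),
    forall x, (pi x == 0) = (x \in P).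
Proof.
move=> idP primeP.
pose mP := isIdealr.Build A P idP.
pose I : idealr A := HB.pack P mP.
pose p : {rmorphism A -> {ideal_quot I}} := \pi_({ideal_quot I})%qT.
have p0 x : (p x == 0) = (x \in P).
  by rewrite -(rmorph0 p) -Quotient.idealrBE subr0.
have domQ : GRing.integral_domain_axiom {ideal_quot I}.
  elim/quotW=> x; elim/quotW=> y; rewrite -[X in X * _]/(p x) -[X in _ * X]/(p y).
  by rewrite -rmorphM !p0 => /eqP; rewrite p0; apply: primeP.
have [E [j jinj]] := domain_embeds_in_field domQ.
by exists E, (j \o p) => x /=; rewrite -(rmorph0 j) (inj_eq jinj) p0.
Qed.

(* Ideals are given as sets here, and may be improper. *)
Definition ideal_set (A : nzRingType) (I : set A) : Prop :=
  I 0 /\ forall a u v, I u -> I v -> I (a * u + v).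

(** [P] is maximal among the ideals that contain [I] and avoid the powers of [f]. For [x] outside
    [P] the larger ideal [P + A x] contains a power of [f], which is the last clause; if [u] and [v]
    are both outside [P] but [u v] is in [P], multiplying two such relations puts a power of [f] in
    [P]. The last clause makes [A / P] a G-domain. *)
Lemma ideal_avoiding_powers (A : comNzRingType) (I : set A) (f : A) :
  ideal_set I -> (forall n, ~ I (f ^+ n)) ->
  exists P : {pred A}, [/\ idealr_closed P, prime_idealr_closed P,
    forall x, I x -> x \in P, f \notin P &
    forall x, x \notin P -> exists n y, f ^+ n - y * x \in P].
Proof.
move=> [I0 IM] If.
pose good (X : set A) := [/\ ideal_set X, I `<=` X & forall n, ~ X (f ^+ n)].
(* [set0] is there for the empty chain. *)
have [F FI totF|P0 [P0good P0max]] :=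
    @Zorn_bigcup A [set X | X = set0 \/ good X].
  case: (pselect (exists2 X, F X & X !=set0)) => [[X FX [x Xx]]|F0]; last first.
    left; rewrite -subset0 => x [X FX Xx]; apply: F0; exists X => //.
    by exists x.
  have FIg Y y : F Y -> Y y -> good Y.
    by move=> FY Yy; case: (FI _ FY) => // Y0; rewrite Y0 in Yy.
  have [[X0 XM] IX Xf] := FIg _ _ FX Xx.
  right; split; [split| |].
  - by exists X.
  - move=> a u v [U FU Uu] [V FV Vv].
    have [[U0 UM] _ _] := FIg _ _ FU Uu.
    have [[V0 VM] _ _] := FIg _ _ FV Vv.
    by case: (totF _ _ FU FV) => [/(_ _ Uu) ? | /(_ _ Vv) ?];
      [exists V => //; apply: VM | exists U => //; apply: UM].
  - by move=> i Ii; exists X => //; apply: IX.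
  - by move=> n [Y FY Yf]; have [_ _ /(_ n)] := FIg _ _ FY Yf; apply.
have goodI : good I by split.
have [[P00 P0M] IP0 P0f] : good P0.
  case: P0good => // P0E; exfalso; apply: (P0max I); last by right.
  rewrite P0E properEneq; split => //.
  by apply/eqP=> I_0; have := I0; rewrite -I_0.
have P0A a u : P0 u -> P0 (a * u) by move=> Pu; have := P0M a u 0 Pu P00; rewrite addr0.
have P0D u v : P0 u -> P0 v -> P0 (u + v).
  by move=> Pu Pv; rewrite -[u]mul1r; apply: P0M.
have hit x : ~ P0 x -> exists n y, P0 (f ^+ n - y * x).
  move=> Px; pose X := [set z | exists y, P0 (z - y * x)].
  have P0X : P0 `<` X.
    split=> [z Pz|XP]; first by exists 0; rewrite mul0r subr0.
    by apply: Px; apply: XP; exists 1; rewrite mul1r subrr.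
  apply: contrapT => nhit; apply: (P0max X P0X); right; split; [split| |].
  - by exists 0; rewrite mul0r subr0.
  - move=> a u v [y Py] [z Pz]; exists (a * y + z).
    have -> : a * u + v - (a * y + z) * x = a * (u - y * x) + (v - z * x).
      by rewrite mulrDl mulrBr opprD addrACA mulrA.
    exact: P0M.
  - by move=> z /IP0/(properW P0X).
  - by move=> n [y Py]; apply: nhit; exists n, y.
pose P : {pred A} := fun x => `[< P0 x >].
have mem x : (x \in P) = `[< P0 x >] by [].
exists P; split.
- split; first by rewrite mem; apply/asboolP.
    by rewrite mem; apply/asboolP; have := P0f 0; rewrite expr0.
  by move=> a u v; rewrite !mem => /asboolP ? /asboolP ?; apply/asboolP/P0M.
- move=> u v; rewrite !mem => /asboolP Puv; apply/orP.
  case: (pselect (P0 u)) => [Pu|/hit[n [y Pu]]]; first by left; apply/asboolP.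
  case: (pselect (P0 v)) => [Pv|/hit[m [z Pv]]]; first by right; apply/asboolP.
  exfalso; apply: (P0f (n + m)).
  have -> : f ^+ (n + m) = f ^+ m * (f ^+ n - y * u)
      + (y * u * (f ^+ m - z * v) + y * z * (u * v)).
    by rewrite !mulrBr [y * z * _]mulrACA subrK [y * u * _]mulrC subrK mulrC exprD.
  by apply: (P0D); [|apply: (P0D)]; apply: P0A.
- by move=> x /IP0 Px; rewrite mem; apply/asboolP.
- by rewrite mem; apply/asboolP; have := P0f 1; rewrite expr1.
- move=> x; rewrite mem => /asboolP/hit[n [y Py]]; exists n, y.
  by rewrite mem; apply/asboolP.
Qed.

(** * Integral elements *)

Lemma splitting_field (K : fieldType) (p : {poly K}) :
  p \is monic ->
  exists (E : fieldType) (j : {rmorphism K -> E}) (s : seq E),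
    map_poly j p = \prod_(z <- s) ('X - z%:P).
Proof.
have [n] := ubnP (size p); elim: n => // n IHn in K p *; rewrite ltnS => size_p.
move=> mon_p; have [size1|size_gt1] := leqP (size p) 1.
  exists K, idfun, [::]; rewrite big_nil (size1_polyC size1) map_polyC /=.
  have := monicP mon_p; rewrite lead_coefE (eqP (_ : size p == 1)) ?size_poly1 //.
    by move=> ->.
  by rewrite eqn_leq size1 size_poly_gt0 monic_neq0.
(* With [f = 1], avoiding powers means being proper. The class of ['X] modulo a prime ideal
   containing [p] is a root of [p]. *)
have [|m|P [idP primeP pP _ _]] :=
  @ideal_avoiding_powers _ [set q : {poly K} | p %| q] 1.
- split=> [|a u v pu pv] /=; first exact: dvdp0.
  by rewrite dvdp_add ?dvdp_mull.
- by rewrite /= expr1n dvdp1 => /eqP sp; rewrite sp in size_gt1.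
have [E0 [pi pi0]] := prime_ideal_residue_field idP primeP.
pose j0 : {rmorphism K -> E0} := pi \o polyC.
have root0 : root (map_poly j0 p) (pi 'X).
  by rewrite rootE -[_.[_]](poly_initial pi p) pi0 pP /=.
have [q pq] := factor_theorem _ _ root0.
have mon_q : q \is monic.
  by rewrite -(monicMr _ (monicXsubC (pi 'X))) -pq map_monic.
have size_q : (size q < n)%N.
  apply: leq_trans size_p; rewrite -(size_map_poly j0 p) [map_poly _ _]pq.
  by rewrite size_monicM ?polyXsubC_eq0 ?size_XsubC ?addn2.
have [E [j [s qs]]] := IHn _ _ size_q mon_q.
exists E, (j \o j0), (j (pi 'X) :: s).
rewrite big_cons map_poly_comp pq rmorphM /= qs mulrC.
by rewrite rmorphB /= map_polyX map_polyC.
Qed.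

Section IntegralCombinations.
Variables (R : comNzRingType) (E : fieldType) (phi : {rmorphism R -> E}).

Lemma integral_exp x n : integralOver phi x -> integralOver phi (x ^+ n).
Proof.
move=> ix; elim: n => [|n IHn]; first exact: integral1.
by rewrite exprS; apply: integral_mul.
Qed.

Lemma integral_sum (I : Type) (r : seq I) (P : pred I) (F : I -> E) :
  (forall i, P i -> integralOver phi (F i)) ->
  integralOver phi (\sum_(i <- r | P i) F i).
Proof.
move=> intF; apply: (big_ind (integralOver phi)) => //; first exact: integral0.
exact: integral_add.
Qed.

Lemma integral_coef_prod_XsubC (s : seq E) :
  (forall z, z \in s -> integralOver phi z) ->
  forall i, integralOver phi (\prod_(z <- s) ('X - z%:P))`_i.
Proof.
elim: s => [_ i|z s IHs int_s i].
  by rewrite big_nil coef1; case: eqP => _; [apply: integral1 | apply: integral0].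
have {}IHs i' : integralOver phi (\prod_(z <- s) ('X - z%:P))`_i'.
  by apply: IHs => y ys; apply: int_s; rewrite inE ys orbT.
rewrite big_cons mulrBl coefB coefXM mul_polyC coefZ; apply: integral_sub.
  by case: eqP => _ //; apply: integral0.
by apply: integral_mul => //; apply: int_s; apply: mem_head.
Qed.

End IntegralCombinations.

Section IntegralElements.
Variables (R : comNzRingType) (E : fieldType) (phi : {rmorphism R -> E}).

(* The coefficients are symmetric functions of roots of [p]. *)
Lemma integral_coef_monic_factor (p : {poly R}) (g : {poly E}) :
  p \is monic -> g \is monic -> g %| map_poly phi p ->
  forall i, integralOver phi g`_i.
Proof.
move=> mon_p mon_g g_p i.
have [M [j [s ps]]] := splitting_field (monic_map phi mon_p).
have int_s z : z \in s -> integralOver (j \o phi) z.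
  by move=> zs; exists p => //; rewrite map_poly_comp ps root_prod_XsubC.
have [m gm] : {m | map_poly j g %= \prod_(z <- mask m s) ('X - z%:P)}.
  by apply: dvdp_prod_XsubC; rewrite -ps dvdp_map.
have jg : map_poly j g = \prod_(z <- mask m s) ('X - z%:P).
  by apply/eqP; rewrite -eqp_monic ?map_monic ?monic_prod_XsubC.
have [r mon_r r0] : integralOver (j \o phi) (map_poly j g)`_i.
  rewrite jg; apply: integral_coef_prod_XsubC => z /mem_mask; exact: int_s.
by exists r => //; rewrite coef_map map_poly_comp fmorph_root in r0.
Qed.

(** With [a] the leading coefficient and [n] the degree, multiplying [p(x) = 0] by [a^(n-1)] gives a
    monic equation for [a x]. *)
Lemma integral_lead_coefM (p : {poly R}) (x : E) :
  map_poly phi p != 0 -> root (map_poly phi p) x ->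
  exists2 a, phi a != 0 & integralOver phi (phi a * x).
Proof.
set q := map_poly phi p => q0 qx.
pose n := (size q).-1; pose a := p`_n.
have qa : phi a = lead_coef q by rewrite lead_coefE coef_map.
have size_q : size q = n.+1 by rewrite prednK ?size_poly_gt0.
have n_gt0 : (0 < n)%N.
  rewrite lt0n; apply/eqP=> n0; move: qx q0.
  rewrite (size1_polyC (_ : size q <= 1)%N) ?size_q ?n0 // rootC polyC_eq0.
  by move=> ->.
exists a; first by rewrite qa lead_coef_eq0.
exists ('X^n + \poly_(i < n) (p`_i * a ^+ (n.-1 - i))).
  rewrite monicE lead_coefDl ?lead_coefXn // size_polyXn ltnS.
  exact: size_poly.
rewrite rmorphD /= map_polyXn rootE hornerD hornerXn.
have -> : map_poly phi (\poly_(i < n) (p`_i * a ^+ (n.-1 - i))) =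
    \poly_(i < n) (q`_i * phi a ^+ (n.-1 - i)).
  apply/polyP=> i; rewrite coef_map coef_poly [RHS]coef_poly /=.
  case: ifP => _; last first.
    exact: rmorph0.
  by rewrite rmorphM rmorphXn coef_map.
rewrite horner_poly; apply/eqP.
transitivity (phi a ^+ n.-1 * q.[x]); last by rewrite (rootP qx) mulr0.
rewrite horner_coef size_q big_ord_recr /= -/n mulrDr mulr_sumr addrC.
congr (_ + _); last first.
  by rewrite -[q`_n]lead_coefE -qa exprMn mulrA -exprSr prednK.
apply: eq_bigr => i _; rewrite exprMn mulrA [RHS]mulrA; congr (_ * _).
rewrite -mulrA -exprD subnK; first exact: mulrC.
by rewrite -ltnS prednK.
Qed.

(** Cancel powers of [y] from its integral equation until the constant term [c] is nonzero in [E].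
    The equation then reads [r(y) y + c = 0], so [c / y = - r(y)] is integral. *)
Lemma integral_scaled_inv (y : E) :
  y != 0 -> integralOver phi y ->
  exists2 b, phi b != 0 & integralOver phi (phi b / y).
Proof.
move=> y0 int_y; case: (int_y) => r.
elim/poly_ind: r => [|r c IHr].
  by rewrite monicE lead_coef0 eq_sym oner_eq0.
move=> mon_rc; have [r0|r0] := eqVneq r 0.
  move: mon_rc; rewrite r0 mul0r add0r monicE lead_coefC => /eqP ->.
  by rewrite rmorph1 (negPf (root1 _)).
have mon_r : r \is monic.
  move: mon_rc; rewrite !monicE lead_coefDl ?lead_coefMX //.
  by rewrite size_mulX // size_polyC ltnS (leq_trans (leq_b1 _)) ?size_poly_gt0.
rewrite rmorphD rmorphM /= map_polyX map_polyC /= rootE hornerMXaddC => rc.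
have [c0|c0] := eqVneq (phi c) 0.
  move: rc; rewrite c0 addr0 mulf_eq0 (negPf y0) orbF -rootE; exact: IHr.
exists c => //.
have -> : phi c / y = - (map_poly phi r).[y].
  rewrite -[_.[y]](mulfK y0) -mulNr; congr (_ / _).
  by apply/eqP; rewrite -addr_eq0 addrC.
apply: integral_opp; apply: integral_horner => //.
by apply/integral_poly => i; rewrite coef_map; apply: integral_id.
Qed.

Lemma integral_scaled_horner (a : R) (x : E) (g : {poly R}) :
  integralOver phi (phi a * x) ->
  integralOver phi (phi a ^+ size g * (map_poly phi g).[x]).
Proof.
move=> int_ax; rewrite (horner_coef_wide _ (size_poly _ _)).
rewrite mulr_sumr; apply: integral_sum => i _.
rewrite coef_map mulrCA; apply: integral_mul; first exact: integral_id.
have -> : phi a ^+ size g = phi a ^+ (size g - i) * phi a ^+ i.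
  by rewrite -exprD subnK // ltnW.
rewrite -mulrA -exprMn -rmorphXn.
by apply: integral_mul; [apply: integral_id | apply: integral_exp].
Qed.

(** Multiplying the integral equation of [u / s], of degree [n], by [s^n] expresses [u^n] as a sum
    of terms [u^i s^(n-i)] with [i < n], all divisible by [s]. *)
Lemma integral_fraction_dvd (s u : R) :
  phi s != 0 -> integralOver phi (phi u / phi s) ->
  exists n s', phi s * phi s' = phi u ^+ n.
Proof.
move=> s0 [r mon_r]; rewrite rootE.
pose n := (size r).-1.
have size_r : size r = n.+1 by rewrite prednK ?size_poly_gt0 ?monic_neq0.
have rn : r`_n = 1 by rewrite -lead_coefE; apply/monicP.
have size_phir : (size (map_poly phi r) <= size r)%N := size_poly _ _.
rewrite (horner_coef_wide _ size_phir) size_r big_ord_recr /=.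
rewrite coef_map /= rn rmorph1 mul1r addr_eq0 -eqr_oppLR => /eqP zn.
exists n, (- \sum_(i < n) r`_i * u ^+ i * s ^+ (n.-1 - i)).
have -> : phi u ^+ n = phi s ^+ n * (phi u / phi s) ^+ n.
  by rewrite exprMn exprVn mulrC divfK ?expf_neq0.
rewrite -zn rmorphN /= !mulrN; congr (- _).
rewrite rmorph_sum !mulr_sumr; apply: eq_bigr => i _.
have s_i : phi s ^+ n / phi s ^+ i = phi s * phi s ^+ (n.-1 - i).
  have n_i : n = ((n.-1 - i).+1 + i)%N.
    move: (nat_of_ord i) (ltn_ord i) => m; case: (n) => //= n'.
    by rewrite ltnS addSn => /subnK ->.
  by rewrite {1}n_i exprD mulfK ?expf_neq0 // exprS.
rewrite coef_map !rmorphM !rmorphXn /= exprMn exprVn.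
by rewrite mulrCA -s_i mulrCA -mulrA.
Qed.
End IntegralElements.

(** * G-domains and the Nullstellensatz *)

(* A set [T] (meant to be a subring) whose fraction field is obtained by
   inverting a single element. *)
Definition G_domain (E : fieldType) (T : set E) : Prop :=
  exists v, [/\ T v, v != 0 & forall t, T t -> t != 0 ->
    exists n t', T t' /\ t * t' = v ^+ n].

Definition eval_at (R : comNzRingType) (E : fieldType) (phi : {rmorphism R -> E})
    (x : E) : {rmorphism {poly R} -> E} :=
  horner_morph (fun a => mulrC x (phi a)).

Section GDomain.
Variables (R : comNzRingType) (E : fieldType) (phi : {rmorphism R -> E}).
Variable x : E.

Lemma eval_atE p : eval_at phi x p = (map_poly phi p).[x].
Proof. by []. Qed.

Hypothesis G_x : G_domain (range (eval_at phi x)).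

(* If [x] were transcendental, [1 + x v] would divide a power of [v], hence
   would be a unit of the polynomial ring. *)
Lemma G_domain_algebraic :
  exists2 p, map_poly phi p != 0 & root (map_poly phi p) x.
Proof.
have [v [[V _ vV] v0 Gv]] := G_x.
apply: contrapT => trans.
have map0 p : eval_at phi x p = 0 -> map_poly phi p = 0.
  move=> px; apply/eqP; apply: contrapT => /negP p0; apply: trans.
  by exists p; rewrite ?rootE -?eval_atE ?px.
pose W : {poly R} := 1 + V * 'X.
have w0 : eval_at phi x W != 0.
  apply/eqP => /map0/(congr1 (fun p : {poly E} => p`_0))/eqP.
  by rewrite coef_map coefD coef1 coefMX /= addr0 rmorph1 coef0 (negPf (oner_neq0 _)).
have [n [_ [[T _ <-] wT]]] := Gv _ (ex_intro2 _ _ _ I (erefl _)) w0.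
(* A truncated geometric series for the inverse of [1 + V X]. Its error term [(- V X)^n] is
   corrected by [(- X)^n T], because [W T] and [V^n] agree at [x]. *)
pose H : {poly R} := \sum_(i < n) (- (V * 'X)) ^+ i + (- 'X) ^+ n * T.
have WH : map_poly phi (W * H - 1) = 0.
  apply: map0; apply/eqP; rewrite rmorphB rmorph1 subr_eq0.
  rewrite mulrDr rmorphD.
  have -> : W * \sum_(i < n) (- (V * 'X)) ^+ i = 1 - (- (V * 'X)) ^+ n.
    by rewrite -[RHS]opprB subrX1 -[RHS]mulNr opprB opprK.
  rewrite mulrCA [X in _ + X]rmorphM [eval_at phi x (W * T)]rmorphM wT -vV.
  rewrite -rmorphXn -rmorphM -rmorphD /=.
  by rewrite -mulrN mulrC exprMn subrK rmorph1.
have : map_poly phi W * map_poly phi H = 1.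
  by apply/eqP; rewrite -subr_eq0 -WH rmorphB rmorphM rmorph1.
move/(congr1 (fun p : {poly E} => size p)).
have V0 : map_poly phi V != 0.
  apply: contra_neq v0 => V0; by rewrite -vV eval_atE V0 horner0.
have sW : size (map_poly phi W) = (size (map_poly phi V)).+1.
  rewrite rmorphD rmorphM rmorph1 /= map_polyX addrC size_polyDl size_mulX //.
  by rewrite size_poly1 ltnS size_poly_gt0.
have [->|H0] := eqVneq (map_poly phi H) 0; first by rewrite mulr0 size_poly0 size_poly1.
rewrite size_mul //; last by rewrite -size_poly_gt0 sW.
rewrite size_poly1 sW addSn /=; move: V0 H0; rewrite -!size_poly_gt0.
by case: (size _) => // a _; case: (size _) => // b _; rewrite addnS.
Qed.

(** Since [x] is algebraic, some [a x] is integral, and then so is some [b / v] with [b] from [R].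
    If [s] in [R] divides a power of [v] in [R[x]], then a power of [a b] divided by [s] is integral
    over [R], so [s] divides a power of [a b] in the image of [R]. *)
Lemma G_domain_restrict : G_domain (range phi).
Proof.
have [v [[V _ vV] v0 Gv]] := G_x.
have [p p0 px] := G_domain_algebraic.
have [a a0 int_ax] := integral_lead_coefM p0 px.
have int_eval (g : {poly R}) : integralOver phi (phi a ^+ size g * eval_at phi x g).
  exact: integral_scaled_horner.
have av0 : phi a ^+ size V * v != 0 by rewrite mulf_neq0 ?expf_neq0.
have [|b b0 int_b] := @integral_scaled_inv _ _ phi _ av0; first by rewrite -vV.
have int_bv : integralOver phi (phi b / v).
  have -> : phi b / v = phi a ^+ size V * (phi b / (phi a ^+ size V * v)).
    by rewrite invfM mulrCA mulVKf // expf_neq0.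
  by apply: integral_mul => //; rewrite -rmorphXn; apply: integral_id.
exists (phi (a * b)); split; first by exists (a * b).
  by rewrite rmorphM mulf_neq0.
move=> _ [s _ <-] s0.
have [|n [_ [[g _ <-] sg]]] := Gv (phi s) _ s0.
  by exists s%:P => //; rewrite eval_atE map_polyC hornerC.
have int_u : integralOver phi (phi ((a * b) ^+ (n + size g)) / phi s).
  (* Here [g(x) = v^n / s]: the factor [b^n] compensates [v^n], and [a^(size g)] clears the
     denominators of [g(x)]. *)
  have -> : phi ((a * b) ^+ (n + size g)) / phi s =
      (phi b / v) ^+ n * (phi a ^+ size g * eval_at phi x g) *
      phi (a ^+ n * b ^+ size g).
    have -> : eval_at phi x g = v ^+ n / phi s by rewrite -sg mulrC mulKf.
    have -> : (phi b / v) ^+ n = phi b ^+ n / v ^+ n by rewrite exprMn exprVn.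
    rewrite rmorphXn !rmorphM !rmorphXn exprMn !exprD.
    rewrite [X in _ = X * _]mulrACA mulKf ?expf_neq0 // [RHS]mulrAC.
    congr (_ / _).
    by rewrite [RHS]mulrACA [LHS]mulrACA [phi b ^+ n * _]mulrC.
  apply: integral_mul; last exact: integral_id.
  by apply: integral_mul => //; apply: integral_exp.
have [m [s' ss']] := integral_fraction_dvd s0 int_u.
exists ((n + size g) * m)%N, (phi s'); split; first by exists s'.
by rewrite ss' -!rmorphXn exprM.
Qed.
End GDomain.

(** The subring generated by [xs] over the image of [R]. Each adjunction replaces the base ring by
    polynomials over it, hence the quantification over [R] inside the recursion. *)
Fixpoint adjoin_seq (E : fieldType) (xs : seq E) :
    forall R : comNzRingType, {rmorphism R -> E} -> set E :=
  match xs with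
  | [::] => fun R phi => range phi
  | x :: xs' => fun R phi => adjoin_seq xs' (eval_at phi x)
  end.

Section AdjoinSeq.
Variable E : fieldType.
Implicit Types (xs : seq E) (R : comNzRingType).

Lemma eval_atC R (phi : {rmorphism R -> E}) x a : eval_at phi x a%:P = phi a.
Proof. by rewrite eval_atE map_polyC hornerC. Qed.

Lemma eval_atX R (phi : {rmorphism R -> E}) x : eval_at phi x 'X = x.
Proof. by rewrite eval_atE map_polyX hornerX. Qed.

Lemma adjoin_seq_range xs R (phi : {rmorphism R -> E}) :
  exists (S : comNzRingType) (psi : {rmorphism S -> E}),
    adjoin_seq xs phi = range psi.
Proof.
elim: xs R phi => [|x xs IHxs] R phi /=; first by exists R, phi.
exact: IHxs.
Qed.

Lemma range_sub_adjoin_seq xs R (phi : {rmorphism R -> E}) :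
  range phi `<=` adjoin_seq xs phi.
Proof.
elim: xs R phi => [|x xs IHxs] R phi /=; first exact: subset_refl.
move=> _ [a _ <-].
by apply: IHxs; exists a%:P => //; rewrite eval_atC.
Qed.

Lemma mem_adjoin_seq xs R (phi : {rmorphism R -> E}) x :
  x \in xs -> adjoin_seq xs phi x.
Proof.
elim: xs R phi => [|y xs IHxs] R phi /=; first by rewrite in_nil.
rewrite inE => /predU1P[->|]; last exact: IHxs.
by apply: range_sub_adjoin_seq; exists 'X => //; rewrite eval_atX.
Qed.

Lemma adjoin_seq_sub (A : comNzRingType) (pi : {rmorphism A -> E}) xs R
    (phi : {rmorphism R -> E}) :
  range phi `<=` range pi -> (forall x, x \in xs -> range pi x) ->
  adjoin_seq xs phi `<=` range pi.
Proof.
elim: xs R phi => [|x xs IHxs] R phi phi_pi xs_pi //=; apply: IHxs; last first.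
  by move=> y ys; apply: xs_pi; rewrite inE ys orbT.
have [y _ yx] := xs_pi _ (mem_head _ _).
move=> _ [p _ <-]; elim/poly_ind: p => [|p c [z _ IHp]].
  by exists 0; rewrite ?rmorph0.
have [d _ dc] : range pi (phi c) by apply: phi_pi; exists c.
exists (z * y + d) => //.
by rewrite !rmorphD !rmorphM /= IHp yx dc eval_atC eval_atX.
Qed.

Lemma G_domain_adjoin_seq xs R (phi : {rmorphism R -> E}) :
  G_domain (adjoin_seq xs phi) -> G_domain (range phi).
Proof.
elim: xs R phi => [|x xs IHxs] R phi //= /IHxs; exact: G_domain_restrict.
Qed.

(** A form of Zariski's lemma. The G-domain property descends to each intermediate ring, so each
    generator is algebraic over the preceding one, hence integral over the field [k]. *)
Lemma integral_adjoin_seq (k : fieldType) (phi0 : {rmorphism k -> E}) xs R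
    (phi : {rmorphism R -> E}) :
  (forall a, integralOver phi0 (phi a)) -> G_domain (adjoin_seq xs phi) ->
  forall y, adjoin_seq xs phi y -> integralOver phi0 y.
Proof.
elim: xs R phi => [|x xs IHxs] R phi int_phi /= Gxs y; first by case=> a _ <-.
have [p p0 px] := G_domain_algebraic (G_domain_adjoin_seq Gxs).
apply: IHxs Gxs y => g.
have int_map h : {in map_poly phi h : seq E, integralRange phi0}.
  by apply/integral_poly => i; rewrite coef_map; apply: int_phi.
rewrite eval_atE; apply: integral_horner => //.
exact: integral_root px _.
Qed.

End AdjoinSeq.

(** * Maximal ideals and algebraic residue fields *)

Lemma maximal_ideal_inv (A : comNzRingType) (m : {pred A}) (x : A) :
  maximal_ideal m -> x \notin m -> exists y, 1 - y * x \in m.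
Proof.
move=> [[m0 m1 mM] maxm] xm.
(* [J] is the ideal [m + A x]; if proper, it would equal [m] and yet contain [x]. *)
pose J : {pred A} := fun z => `[< exists y, z - y * x \in m >].
have memJ z : z \in J <-> exists y, z - y * x \in m.
  by rewrite unfold_in; split=> /asboolP.
apply: contrapT => no_inv.
have idJ : idealr_closed J.
  split.
  - by apply/memJ; exists 0; rewrite mul0r subr0.
  - by apply/negP => /memJ.
  - move=> a u v /memJ[y uy] /memJ[z vz]; apply/memJ; exists (a * y + z).
    have -> : a * u + v - (a * y + z) * x = a * (u - y * x) + (v - z * x).
      by rewrite mulrDl mulrBr opprD addrACA mulrA.
    exact: mM.
move/negP: xm; apply; apply: (maxm J) => //.
  by move=> z zm; apply/memJ; exists 0; rewrite mul0r subr0.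
by apply/memJ; exists 1; rewrite mul1r subrr.
Qed.

Lemma maximal_ideal_prime (A : comNzRingType) (m : {pred A}) :
  maximal_ideal m -> prime_idealr_closed m.
Proof.
move=> maxm u v uv; have [//|um] := boolP (u \in m).
have [y yu] := maximal_ideal_inv maxm um.
have [[m0 m1 mM] _] := maxm.
have -> : v = v * (1 - y * u) + (y * (u * v) + 0).
  by rewrite addr0 mulrBr mulr1 (mulrC v) -mulrA subrK.
by apply: (mM) => //; apply: mM.
Qed.

Section Nullstellensatz.
Variables (k : fieldType) (A : comAlgType k).
Hypothesis A_fg : finitely_generated_algebra A.

Lemma integral_residue_field (P : {pred A}) (f : A) :
  idealr_closed P -> prime_idealr_closed P -> f \notin P ->
  (forall x, x \notin P -> exists n y, f ^+ n - y * x \in P) ->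
  exists (E : fieldType) (pi : {rmorphism A -> E}),
    (forall x, (pi x == 0) = (x \in P)) /\
    forall a, integralOver (pi \o in_alg A) (pi a).
Proof.
move=> idP primeP fP GP.
have [E [pi pi0]] := prime_ideal_residue_field idP primeP.
exists E, pi; split=> //.
pose phi0 : {rmorphism k -> E} := pi \o in_alg A.
have [s gen_s] := A_fg.
pose xs := [seq pi a | a <- s].
have xs_pi : adjoin_seq xs phi0 `<=` range pi.
  apply: adjoin_seq_sub => [_ [c _ <-]|_ /mapP[a _ ->]]; last by exists a.
  by exists c%:A.
have pi_xs a : adjoin_seq xs phi0 (pi a).
  have [S [psi psiE]] := adjoin_seq_range xs phi0; rewrite psiE.
  (* [T] is a subalgebra containing the generators [s], hence all of [A]. *)
  pose T : {pred A} := fun a => `[< range psi (pi a) >].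
  have memT z : z \in T <-> range psi (pi z).
    by rewrite unfold_in; split=> /asboolP.
  apply/memT; apply: gen_s.
    split.
    - by apply/memT; exists 1; rewrite ?rmorph1.
    - move=> c u v /memT[y _ yu] /memT[z _ zv]; apply/memT.
      have [c' _ cc'] : range psi (phi0 c).
        by rewrite -psiE; apply: range_sub_adjoin_seq; exists c.
      exists (c' * y + z) => //; rewrite !rmorphD !rmorphM /= yu zv cc'.
      by rewrite /= -rmorphM mulr_algl.
    - move=> u v /memT[y _ yu] /memT[z _ zv]; apply/memT; exists (y * z) => //.
      by rewrite !rmorphM /= yu zv.
  move=> z zs; apply/memT; rewrite -psiE; apply: mem_adjoin_seq.
  exact: map_f.
move=> a; apply: (@integral_adjoin_seq E k phi0 xs _ phi0) => //.
  by move=> c; apply: integral_id.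
exists (pi f); split; [exact: pi_xs | by rewrite pi0 |].
move=> t /xs_pi[x _ <-]; rewrite pi0 => /GP[n [y Py]]; exists n, (pi y).
split; first exact: pi_xs.
apply/eqP; rewrite -subr_eq0 -rmorphM -rmorphXn -rmorphB pi0 -opprB.
have [P0 P1 PM] := idP.
by rewrite mulrC -mulN1r -[_ * _]addr0; apply: PM.
Qed.

Lemma maximal_residue_field (m : {pred A}) :
  maximal_ideal m ->
  exists (E : fieldType) (pi : {rmorphism A -> E}),
    (forall x, (pi x == 0) = (x \in m)) /\
    forall a, integralOver (pi \o in_alg A) (pi a).
Proof.
move=> maxm; apply: (@integral_residue_field m 1).
- by case: maxm.
- exact: maximal_ideal_prime.
- by case: maxm => [[]].
- move=> x /(maximal_ideal_inv maxm)[y xy]; exists 0, y; by rewrite expr0.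
Qed.

(** The prime [P] obtained from [I] and [f] is already maximal: [A / P] is a domain algebraic over
    [k], so the inverse of a nonzero class is integral over [A], and [integral_fraction_dvd] with
    [u = 1] brings it back into [A / P]. *)
Lemma maximal_ideal_avoiding_powers (I : set A) (f : A) :
  ideal_set I -> (forall n, ~ I (f ^+ n)) ->
  exists m : {pred A}, [/\ maximal_ideal m, forall x, I x -> x \in m & f \notin m].
Proof.
move=> idI If.
have [P [idP primeP IP fP GP]] := ideal_avoiding_powers idI If.
exists P; split => //; split => // J [J0 J1 JM] PJ x xJ.
have [E [pi [pi0 int_pi]]] := integral_residue_field idP primeP fP GP.
apply: contraTT xJ; rewrite -pi0 => pix.
have [|n [y xy]] := @integral_fraction_dvd _ _ pi x 1 pix.
  rewrite rmorph1 div1r; have [q mon_q qx] := integral_inv (int_pi x).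
  by exists (map_poly (in_alg A) q); rewrite ?monic_map // -map_poly_comp.
have Py : 1 - y * x \in P.
  by rewrite -pi0 rmorphB rmorphM rmorph1 mulrC xy rmorph1 expr1n subrr.
apply: contra J1 => xJ; have := JM y _ _ xJ (PJ _ Py).
by rewrite addrC subrK.
Qed.

End Nullstellensatz.

(** * Values of polynomials over the ground field *)

Lemma monic_division (R : comNzRingType) (p g : {poly R}) :
  p \is monic -> exists h r, g = h * p + r /\ (size r < size p)%N.
Proof.
move=> mon_p; exists (Pdiv.Ring.rdivp g p), (Pdiv.Ring.rmodp g p); split.
  exact: Pdiv.RingMonic.rdivp_eq.
by rewrite Pdiv.CommonRing.ltn_rmodp monic_neq0.
Qed.

Lemma common_multiple_of_XsubC (k E : fieldType) (phi : {rmorphism k -> E})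
    (s : seq E) :
  (forall z, z \in s -> integralOver phi z) ->
  exists2 Q : {poly k}, Q \is monic &
    \prod_(z <- s) ('X - z%:P) %| map_poly phi Q.
Proof.
elim: s => [_|z s IHs int_s]; first by exists 1; rewrite ?monic1 // big_nil dvd1p.
have [|Q mon_Q sQ] := IHs; first by move=> y ys; apply: int_s; rewrite inE ys orbT.
have [Q' mon_Q' zQ'] := int_s z (mem_head _ _).
exists (Q' * Q); first by rewrite monicMl.
by rewrite big_cons rmorphM dvdp_mul // -root_factor_theorem.
Qed.

(** Asking for the property at every multiple [Q * H] lets the product of the polynomials found at
    the individual points serve all points at once. *)
Lemma monic_common_multiple (k : fieldType) (T : Type) (X : set T)
    (P : T -> {poly k} -> Prop) :
  finite_set X ->
  (forall x, X x -> exists2 Q : {poly k}, Q \is monic & forall H, P x (Q * H)) ->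
  exists2 Q : {poly k}, Q \is monic & forall x, X x -> forall H, P x (Q * H).
Proof.
elim/Pchoice: T => T in X P * => /finite_seqP[s ->].
elim: s => [_|x s IHs ex_Q]; first by exists 1; rewrite ?monic1.
have [|Q mon_Q QP] := IHs; first by move=> y ys; apply: ex_Q; rewrite /= inE ys orbT.
have [Q' mon_Q' Q'P] := ex_Q x (mem_head _ _).
exists (Q' * Q); first by rewrite monicMl.
move=> y /=; rewrite inE => /predU1P[->|/QP Qy] H; first by rewrite -mulrA.
by rewrite [Q' * Q]mulrC -mulrA.
Qed.

(** Modulo [m], [p] splits in some extension with roots algebraic over [k], so it divides some monic
    [Q] over [k]. Modulo [m] it then divides the remainder [r] of any multiple of [Q], and [r]
    vanishes there for degree reasons. *)
Lemma maximal_remainder (k : fieldType) (A : comAlgType k) (m : {pred A})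
    (p : {poly A}) :
  finitely_generated_algebra A -> maximal_ideal m -> p \is monic ->
  exists2 Q : {poly k}, Q \is monic &
    forall (H : {poly k}) (h r : {poly A}),
      map_poly (in_alg A) (Q * H) = h * p + r -> (size r < size p)%N ->
      forall i, r`_i \in m.
Proof.
move=> A_fg maxm mon_p.
have [E [pi [pi0 int_pi]]] := maximal_residue_field A_fg maxm.
have [M [j [s ps]]] := splitting_field (monic_map pi mon_p).
pose phi : {rmorphism k -> M} := j \o (pi \o in_alg A).
have int_s z : z \in s -> integralOver phi z.
  move=> zs; apply: (@integral_root_monic _ _ phi _ (map_poly j (map_poly pi p))).
  - by rewrite !monic_map.
  - by rewrite ps root_prod_XsubC.
  - apply/integral_poly => i; rewrite !coef_map /=.
    exact: integral_rmorph.
have [Q mon_Q sQ] := common_multiple_of_XsubC int_s.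
exists Q => // H h r QH size_r.
have : map_poly (j \o pi) p %| map_poly (j \o pi) r.
  have -> : map_poly (j \o pi) r =
      map_poly phi (Q * H) - map_poly (j \o pi) h * map_poly (j \o pi) p.
    rewrite (map_poly_comp (j \o pi) (in_alg A)) QH rmorphD rmorphM /=.
    by rewrite [X in X - _]addrC addrK.
  rewrite dvdp_sub ?dvdp_mull // rmorphM /= dvdp_mulr //.
  by rewrite (map_poly_comp j pi) ps.
have r_lt : (size (map_poly (j \o pi) r) < size (map_poly (j \o pi) p))%N.
  apply: leq_ltn_trans (size_poly _ _) _.
  by rewrite (size_map_poly_id0 (f := j \o pi)) ?(monicP mon_p) ?rmorph1 ?oner_eq0.
have [r0 _ i|r0 /dvdp_leq] := eqVneq (map_poly (j \o pi) r) 0; last first.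
  by move=> /(_ r0); rewrite leqNgt r_lt.
have := congr1 (fun g : {poly M} => g`_i) r0.
by rewrite coef_map coef0 /= => /eqP; rewrite fmorph_eq0 pi0.
Qed.

(** * The conductor and the isolated non normal points *)

Section IsolatedPoints.
Variables (k : fieldType) (A : idomainAlgType k).
Hypothesis A_fg : finitely_generated_algebra A.
Variable q : {fraction A}.
Hypothesis int_q : integralOver (@tofrac A) q.

Local Notation T := (@tofrac A : {rmorphism A -> {fraction A}}).
Local Notation at_q := (eval_at T q).

(* The conductor of [A] in [A[q]], enlarged to the fraction field. *)
Definition conductor : set {fraction A} :=
  [set y | forall g : {poly A}, range T (y * at_q g)].

Lemma conductorD y z : conductor y -> conductor z -> conductor (y + z).
Proof.
move=> Cy Cz g; have [[a _ ya] [b _ zb]] := (Cy g, Cz g).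
by exists (a + b) => //; rewrite rmorphD ya zb mulrDl.
Qed.

Lemma conductorM y g : conductor y -> conductor (y * at_q g).
Proof. by move=> Cy h; rewrite -mulrA -rmorphM. Qed.

Lemma conductor0 : conductor 0.
Proof. by move=> g; exists 0; rewrite // mul0r rmorph0. Qed.

Lemma conductor_ideal : ideal_set [set x : A | conductor (T x)].
Proof.
split=> [|a u v Cu Cv] /=; first by rewrite rmorph0; apply: conductor0.
rewrite rmorphD rmorphM; apply: conductorD => //.
by rewrite mulrC -(eval_atC T q a); apply: conductorM.
Qed.

(** Normality at [m] gives [q = a / s] with [s] outside [m]. Division by the integral equation [p]
    brings every element of [A[q]] to degree below [size p] in [q], so [s ^+ size p] clears all
    denominators. *)
Lemma conductor_at_normal_point (m : {pred A}) :
  maximal_ideal m -> integrally_closed (local_ring m) ->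
  exists2 s, s \notin m & conductor (T s).
Proof.
move=> maxm normal_m; have [p mon_p pq] := int_q.
have [a [s [sm q_as]]] : local_ring m q.
  apply: normal_m; exists (map_poly T p); split => //; first exact: monic_map.
  move=> i; exists p`_i, 1; case: maxm => [[_ m1 _] _].
  by rewrite m1 rmorph1 divr1 coef_map.
have s0 : T s != 0.
  by rewrite tofrac_eq0; apply: contraNneq sm => ->; case: maxm => [[]].
exists (s ^+ size p).
  elim: (size p) => [|n IHn]; first by rewrite expr0; case: maxm => [[]].
  apply: contra IHn; rewrite exprS => /(maximal_ideal_prime maxm).
  by rewrite (negPf sm).
move=> g; have [h [r [-> size_r]]] := monic_division g mon_p.
rewrite rmorphD rmorphM !eval_atE (rootP pq) mulr0 add0r.
have size_Tr : (size (map_poly T r) <= size p)%N.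
  by apply: leq_trans (size_poly _ _) (ltnW _).
rewrite (horner_coef_wide _ size_Tr) mulr_sumr.
exists (\sum_(i < size p) r`_i * (a ^+ i * s ^+ (size p - i))) => //.
rewrite rmorph_sum; apply: eq_bigr => i _.
rewrite coef_map !rmorphM !rmorphXn /= [RHS]mulrCA; congr (_ * _).
rewrite q_as exprMn exprVn mulrCA; congr (_ * _).
by apply: expfB_cond; rewrite (negPf s0) add0n ltnW.
Qed.

Hypothesis A_isolated : isolated_non_normal_points A.

Lemma conductor_exp (f : A) :
  (forall m, non_normal_point m -> f \in m) ->
  exists n, conductor (T f ^+ n).
Proof.
move=> fm; apply: contrapT => Cf.
have [|m [maxm Cm fm']] := maximal_ideal_avoiding_powers A_fg conductor_ideal (f := f).
  by move=> n /= Cfn; apply: Cf; exists n; rewrite -rmorphXn.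
have [normal_m|not_normal] := pselect (integrally_closed (local_ring m)).
  have [s sm Cs] := conductor_at_normal_point maxm normal_m.
  by move/negP: sm; apply; apply: Cm.
by move/negP: fm'; apply; apply: fm.
Qed.

(** Each term of the binomial expansion has [y^n] or [z^n'] as a factor, with cofactor in [A[q]]. *)
Lemma conductor_expD y z n n' :
  range at_q y -> range at_q z -> conductor (y ^+ n) -> conductor (z ^+ n') ->
  conductor ((y + z) ^+ (n + n')).
Proof.
move=> [g _ <-] [h _ <-] Cy Cz; rewrite exprDn.
apply: (big_ind conductor); [exact: conductor0 | exact: conductorD|].
move=> i _; rewrite -mulr_natr -(rmorph_nat at_q); set c : {poly A} := _%:R.
have [le_n'_i|lt_i_n'] := leqP n' i.
  have -> : at_q g ^+ (n + n' - i) * at_q h ^+ i * at_q c =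
      at_q h ^+ n' * at_q (g ^+ (n + n' - i) * h ^+ (i - n') * c).
    rewrite !rmorphM !rmorphXn [RHS]mulrA; congr (_ * _).
    by rewrite [RHS]mulrC -mulrA -exprD subnK.
  exact: conductorM.
have -> : at_q g ^+ (n + n' - i) * at_q h ^+ i * at_q c =
    at_q g ^+ n * at_q (g ^+ (n' - i) * h ^+ i * c).
  rewrite !rmorphM !rmorphXn -addnBA ?exprD; last exact: ltnW.
  by rewrite !mulrA.
exact: conductorM.
Qed.

Lemma monic_ground_value :
  exists Q : {poly k}, [/\ Q \is monic, (1 < size Q)%N &
    range T (map_poly (T \o in_alg A) Q).[q]].
Proof.
have [p mon_p pq] := int_q.
pose P (m : {pred A}) (Q : {poly k}) := forall (h r : {poly A}),
  map_poly (in_alg A) Q = h * p + r -> (size r < size p)%N -> forall i, r`_i \in m.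
have [|Q mon_Q QP] := @monic_common_multiple k _ _ P A_isolated.
  by move=> m [maxm _]; apply: maximal_remainder.
(* The factor ['X] guarantees positive degree, as [Q] may be [1]. *)
pose QX := Q * 'X; have mon_QX : QX \is monic by rewrite monicMr ?monicX.
have [h [r [Qhr size_r]]] := monic_division (map_poly (in_alg A) QX) mon_p.
have rm i m : non_normal_point m -> r`_i \in m.
  by move=> /QP/(_ 'X) /(_ h r Qhr size_r).
have Qr : (map_poly (T \o in_alg A) QX).[q] = at_q r.
  rewrite map_poly_comp Qhr rmorphD rmorphM hornerD hornerM.
  by rewrite (rootP pq) mulr0 add0r.
(* Every coefficient of [r] lies in all non normal points, so it has a power in the conductor; these
   powers combine along the Horner form of [r]. *)
have [n Cn] : exists n, conductor (at_q r ^+ n).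
  elim/poly_ind: r rm {Qhr size_r Qr} => [|r c IHr] rm.
    by exists 1; rewrite rmorph0 expr1; apply: conductor0.
  have [|n Cr] := IHr.
    by move=> i m /(rm i.+1); rewrite coefD coefMX coefC addr0.
  have [|n' Cc] := @conductor_exp c.
    by move=> m /(rm 0); rewrite coefD coefMX coefC add0r.
  exists (n + n')%N; rewrite rmorphD; apply: conductor_expD.
  - by exists (r * 'X).
  - by exists c%:P.
  - by rewrite rmorphM exprMn -[X in _ * X]rmorphXn; apply: conductorM.
  - by rewrite eval_atC.
(* The exponent [n.+1] keeps the degree positive even when [n = 0]. *)
exists (QX ^+ n.+1); split; first exact: monic_exp.
  have := size_exp QX n.+1; rewrite size_mulX ?monic_neq0 //= mulnS.
  have := monic_neq0 mon_Q; rewrite -size_poly_gt0.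
  by case: (size Q) => // d _; case: (size _) => [|[|]].
have := conductorM r Cn 1; rewrite rmorph1 mulr1 -exprSr -Qr -horner_exp.
by rewrite -[map_poly _ _ ^+ _]rmorphXn.
Qed.
End IsolatedPoints.

(** * Fraction fields and subrings *)

Lemma fraction_div (A : idomainType) (x : {fraction A}) :
  exists a c : A, c != 0 /\ x = tofrac a / tofrac c.
Proof.
elim/quotW: x => x; exists \n_x, \d_x; split; first exact: denom_ratioP.
apply: (canRL (mulfK _)); first by rewrite tofrac_eq0 denom_ratioP.
unlock tofrac.
rewrite -[LHS]FracField.pi_mul.
apply/eqmodP => /=; rewrite /FracField.mulf /= FracField.equivfE.
rewrite !numden_Ratio ?mulr1 ?oner_neq0 ?mulf_neq0 ?denom_ratioP //.
by rewrite mulrC.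
Qed.

(** The value at [x] is chosen to be compatible with every way of writing [x] as a fraction, so sums
    and products can be tested on any common denominator. *)
Lemma fraction_lift (A : idomainType) (E : fieldType) (phi : {rmorphism A -> E}) :
  injective phi ->
  exists f : {rmorphism {fraction A} -> E}, forall a, f (tofrac a) = phi a.
Proof.
move=> phi_inj.
have phi0 (c : A) : c != 0 -> phi c != 0 by rewrite -(inj_eq phi_inj) rmorph0.
have tf0 (c : A) : c != 0 -> tofrac c != 0 by rewrite tofrac_eq0.
have /choice[g gE] (x : {fraction A}) : exists y : E, forall a c,
    c != 0 -> x * tofrac c = tofrac a -> y * phi c = phi a.
  have [a [c [c0 ->]]] := fraction_div x; exists (phi a / phi c) => a' c' c'0.
  rewrite mulrAC => /(canRL (divfK (tf0 _ c0))) /eqP.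
  rewrite -!rmorphM tofrac_eq => /eqP ac.
  apply: (mulIf (phi0 _ c0)); rewrite -!rmorphM -ac rmorphM mulrAC.
  by rewrite [_ * phi c]divfK ?phi0.
have gP x : exists a c, [/\ c != 0, x * tofrac c = tofrac a & g x * phi c = phi a].
  have [a [c [c0 xac]]] := fraction_div x; exists a, c.
  have xc : x * tofrac c = tofrac a by rewrite xac divfK ?tf0.
  by split => //; apply: gE.
have gB : zmod_morphism g.
  move=> x y; have [a [c [c0 xc gx]]] := gP x; have [b [e [e0 ye gy]]] := gP y.
  apply: (mulIf (phi0 _ (mulf_neq0 c0 e0))).
  rewrite (gE _ (a * e - b * c)) ?mulf_neq0 //.
    by rewrite rmorphB !rmorphM -gx -gy -!mulrA (mulrC (phi e)) mulrBl.
  by rewrite rmorphB !rmorphM /= -xc -ye -!mulrA (mulrC (tofrac e)) mulrBl.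
have gM : monoid_morphism g.
  split=> [|x y].
    by rewrite -[g 1]mulr1 -(rmorph1 phi); apply: gE; rewrite ?oner_neq0 // mul1r.
  have [a [c [c0 xc gx]]] := gP x; have [b [e [e0 ye gy]]] := gP y.
  apply: (mulIf (phi0 _ (mulf_neq0 c0 e0))).
  rewrite (gE _ (a * b)) ?mulf_neq0 //.
    by rewrite !rmorphM -gx -gy mulrACA.
  by rewrite !rmorphM /= -xc -ye mulrACA.
pose mB := GRing.isZmodMorphism.Build _ _ g gB.
pose mM := GRing.isMonoidMorphism.Build _ _ g gM.
pose f : {rmorphism {fraction A} -> E} := HB.pack g mB mM.
exists f => a; rewrite -[LHS]mulr1 -(rmorph1 phi).
by apply: gE; rewrite ?oner_neq0 // rmorph1 mulr1.
Qed.

Definition subring_type (B : comNzRingType) (S : subringClosed B) : Type :=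
  {x : B | x \in S}.

Section SubringType.
Variables (B : comNzRingType) (S : subringClosed B).
HB.instance Definition _ := SubChoice.on (subring_type S).
HB.instance Definition _ := [SubChoice_isSubComNzRing of subring_type S by <:].
End SubringType.

(** Turns a subring given as a set, such as [constants_sub], into the source of a morphism, as
    [integralOver] requires. *)
Lemma subring_rmorphism (B : comNzRingType) (S : set B) :
  S 1 -> (forall x y, S x -> S y -> S (x - y)) ->
  (forall x y, S x -> S y -> S (x * y)) ->
  exists (R : comNzRingType) (psi : {rmorphism R -> B}), injective psi /\ range psi = S.
Proof.
move=> S1 SB SM.
pose P : {pred B} := fun x => `[< S x >].
have memP x : x \in P <-> S x by rewrite unfold_in; split=> /asboolP.
have Pring : GRing.subring_closed P.
  by split; [apply/memP | move=> x y /memP Sx /memP Sy; apply/memP; apply: SB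
    | move=> x y /memP Sx /memP Sy; apply/memP; apply: SM].
pose mP := GRing.isSubringClosed.Build B P Pring.
pose P' : subringClosed B := HB.pack P mP.
exists (subring_type P'), (val : subring_type P' -> B); split.
  exact: val_inj.
apply/seteqP; split=> [_ [[x Px] _ <-]|x Sx]; first exact/memP.
have Px : x \in P' by apply/memP.
by exists (Sub x Px) => //; rewrite SubK.
Qed.

(** * Derivations *)

Lemma integral_over_range (R B : comNzRingType) (E : fieldType)
    (psi : {rmorphism R -> B}) (j : {rmorphism B -> E}) (b : B) :
  injective psi -> injective j -> integralOver (j \o psi) (j b) ->
  integral_over (range psi) b.
Proof.
move=> psi_inj j_inj [p mon_p pb]; exists (map_poly psi p); split.
- exact: monic_map.
- by move=> i; rewrite coef_map; exists p`_i.
- move: pb; rewrite map_poly_comp !rootE horner_map /= -(rmorph0 j).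
  by rewrite (inj_eq j_inj).
Qed.

Section Derivation.
Variables (k : fieldType) (B : idomainAlgType k) (d : {linear B -> B}).
Hypothesis d_der : derivation d.

Lemma derivation1 : d 1 = 0.
Proof.
have /eqP := d_der 1 1; rewrite !mulr1 mul1r -subr_eq0 opprD addrA subrr.
by rewrite sub0r oppr_eq0 => /eqP.
Qed.

Lemma derivation_scalar c : d c%:A = 0.
Proof. by rewrite linearZ /= derivation1 scaler0. Qed.

Lemma derivationM_const x b : d b = 0 -> d (x * b) = d x * b.
Proof. by move=> db; rewrite d_der db mulr0 addr0. Qed.

Lemma derivationX_const b n : d b = 0 -> d (b ^+ n) = 0.
Proof.
move=> db; elim: n => [|n IHn]; first exact: derivation1.
by rewrite exprSr derivationM_const // IHn mul0r.
Qed.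

End Derivation.

Lemma constants_subring (k : fieldType) (A B : idomainAlgType k)
    (iota : {lrmorphism A -> B}) (F : set {linear B -> B}) :
  (forall d, F d -> derivation d) ->
  let S := constants_sub iota F in
  [/\ S 1, forall x y, S x -> S y -> S (x - y)
    & forall x y, S x -> S y -> S (x * y)].
Proof.
move=> F_der S; split.
- split; first by exists 1; rewrite ?rmorph1.
  by move=> d /F_der; apply: derivation1.
- move=> _ _ [[x _ <-] cx] [[y _ <-] cy]; split.
    by exists (x - y); rewrite ?rmorphB.
  by move=> d Fd; rewrite linearB /= cx // cy // subrr.
- move=> _ _ [[x _ <-] cx] [[y _ <-] cy]; split.
    by exists (x * y); rewrite ?rmorphM.
  by move=> d Fd; rewrite derivationM_const ?cx ?mul0r ?cy //; apply: F_der.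
Qed.

Section FractionConstants.
Variables (k : fieldType) (A B : idomainAlgType k) (iota : {lrmorphism A -> B}).
Hypothesis iota_inj : injective iota.
Variable d : {linear B -> B}.
Hypothesis d_der : derivation d.

(* By the quotient rule, the last clause says that [d (a / c) = 0] in the
   fraction field of [B]. *)
Definition fraction_constant (x : {fraction A}) : Prop :=
  exists a c : A, [/\ c != 0, x = tofrac a / tofrac c &
    iota c * d (iota a) = iota a * d (iota c)].

Lemma fraction_constant_const a : d (iota a) = 0 -> fraction_constant (tofrac a).
Proof.
move=> da; exists a, 1; split; first exact: oner_neq0.
  by rewrite rmorph1 divr1.
by rewrite rmorph1 da derivation1 // !mulr0.
Qed.

Lemma fraction_constantD x y :
  fraction_constant x -> fraction_constant y -> fraction_constant (x + y).
Proof.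
move=> [a [c [c0 -> ac]]] [b [e [e0 -> be]]]; exists (a * e + b * c), (c * e).
split; first exact: mulf_neq0.
  by rewrite addf_div ?tofrac_eq0 // rmorphD !rmorphM.
rewrite !rmorphD !rmorphM /= linearD /= !d_der.
move: (iota a) (iota b) (iota c) (iota e) ac be => u v w z uw vz.
(* Both sides are regrouped so that the members of the hypotheses [uw] and [vz] appear as
   factors. *)
have -> : w * z * (d u * z + u * d z + (d v * w + v * d w)) =
    (w * d u) * (z * z) + (u * w) * (z * d z) +
    ((z * d v) * (w * w) + (v * z) * (w * d w)).
  rewrite !mulrDr; congr (_ + _ + (_ + _)).
  - by rewrite mulrACA.
  - by rewrite mulrACA (mulrC w u).
  - by rewrite (mulrC w z) mulrACA.
  - by rewrite (mulrC w z) mulrACA (mulrC z v).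
have -> : (u * z + v * w) * (d w * z + w * d z) =
    (u * d w) * (z * z) + (u * w) * (z * d z) +
    ((v * d z) * (w * w) + (v * z) * (w * d w)).
  rewrite mulrDl !mulrDr; congr (_ + _ + _).
  - by rewrite mulrACA.
  - by rewrite mulrACA.
  - rewrite addrC (mulrC w (d z)) mulrACA (mulrC (d w) z) [v * w * _]mulrACA.
    by [].
by rewrite uw vz.
Qed.

Lemma fraction_constantM x y :
  fraction_constant x -> fraction_constant y -> fraction_constant (x * y).
Proof.
move=> [a [c [c0 -> ac]]] [b [e [e0 -> be]]]; exists (a * b), (c * e).
split; first exact: mulf_neq0.
  by rewrite mulf_div !rmorphM.
rewrite !rmorphM /= !d_der.
move: (iota a) (iota b) (iota c) (iota e) ac be => u v w z uw vz.
rewrite !mulrDr.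
have -> : w * z * (d u * v) = (w * d u) * (z * v) by rewrite mulrACA.
have -> : w * z * (u * d v) = (w * u) * (z * d v) by rewrite mulrACA.
have -> : u * v * (d w * z) = (u * d w) * (v * z) by rewrite mulrACA.
have -> : u * v * (w * d z) = (u * w) * (v * d z) by rewrite mulrACA.
by rewrite uw vz (mulrC w u) (mulrC z v).
Qed.

(** Substituting [b = a c] in the quotient rule relation leaves [c^2 d(a) = 0] in the domain [B]. *)
Lemma fraction_constant_tofrac a : fraction_constant (tofrac a) -> d (iota a) = 0.
Proof.
move=> [b [c [c0 abc bc]]].
have ac : a * c = b.
  apply/eqP; rewrite -tofrac_eq rmorphM /= abc divfK ?tofrac_eq0 //.
have ic0 : iota c != 0 by rewrite -(rmorph0 iota) (inj_eq iota_inj).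
move: bc; rewrite -ac rmorphM d_der mulrDr [iota a * iota c]mulrC -mulrA => /eqP.
by rewrite -subr_eq0 addrK !mulf_eq0 (negPf ic0) orbF => /eqP.
Qed.

Lemma fraction_constant_horner (Q : {poly k}) x :
  fraction_constant x ->
  fraction_constant (map_poly (@tofrac A \o in_alg A) Q).[x].
Proof.
move=> cx; elim/poly_ind: Q => [|Q c IHQ].
  rewrite rmorph0 horner0 -(rmorph0 (@tofrac A)).
  by apply: fraction_constant_const; rewrite !rmorph0 linear0.
rewrite rmorphD rmorphM /= map_polyX map_polyC hornerMXaddC.
apply: fraction_constantD; first exact: fraction_constantM.
apply: fraction_constant_const.
by rewrite linearZ /= rmorph1 derivation_scalar.
Qed.

End FractionConstants.

(** * Relations of minimal degree and their coefficients *)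

Section MinimalRelation.
Variables (k : fieldType) (A B : idomainAlgType k) (iota : {lrmorphism A -> B}).
Variable b : B.

Lemma minimal_relation :
  (exists2 p : {poly A}, p != 0 & root (map_poly iota p) b) ->
  exists p : {poly A}, [/\ p != 0, root (map_poly iota p) b &
    forall r : {poly A}, (size r < size p)%N -> root (map_poly iota r) b -> r = 0].
Proof.
move=> [p0 p00 p0b].
pose P n := `[< exists p : {poly A},
  [/\ p != 0, root (map_poly iota p) b & size p = n] >].
have exP : exists n, P n by exists (size p0); apply/asboolP; exists p0.
have [n /asboolP[p [pn0 pb <-]] minp] := ex_minnP exP.
exists p; split=> // r size_r rb; apply/eqP; apply: contraLR size_r => r0.
by rewrite -leqNgt; apply: minp; apply/asboolP; exists r.
Qed.

(* [lead_coef p * p^d - d (lead_coef p) * p] kills [b] and has smaller degree. *)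
Lemma minimal_relation_constant (d : {linear B -> B}) (p : {poly A}) :
  derivation d -> (forall a : A, range iota (d (iota a))) -> d b = 0 ->
  root (map_poly iota p) b ->
  (forall r : {poly A}, (size r < size p)%N -> root (map_poly iota r) b -> r = 0) ->
  forall i, iota (lead_coef p) * d (iota p`_i) = iota p`_i * d (iota (lead_coef p)).
Proof.
move=> d_der d_stable db pb minp i.
have /choice[D DE] (a : A) : exists a' : A, iota a' = d (iota a).
  by have [a' _ da] := d_stable a; exists a'.
have [lt_p|] := ltnP i (size p); last first.
  by move=> /(nth_default 0) ->; rewrite rmorph0 linear0 mulr0 mul0r.
pose n := (size p).-1; pose c := lead_coef p.
have size_p : size p = n.+1 by rewrite prednK // (leq_ltn_trans _ lt_p).
(* The coefficient of degree [n] would be [c * D c - D c * c = 0], so truncating at [n] loses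
   nothing. *)
pose r := \poly_(i < n) (c * D p`_i - D c * p`_i).
have size_r : (size r < size p)%N by rewrite size_p ltnS size_poly.
have r0 : r = 0.
  apply: minp => //.
  have -> : map_poly iota r = \poly_(i < n) (iota c * d (iota p`_i) - d (iota c) * iota p`_i).
    apply/polyP=> l; rewrite coef_map !coef_poly /=.
    by case: ifP => _; rewrite ?rmorph0 // rmorphB !rmorphM /= !DE.
  have size_ip : (size (map_poly iota p) <= n.+1)%N by rewrite -size_p size_poly.
  move: (pb); rewrite !rootE horner_poly (horner_coef_wide _ size_ip).
  move=> /eqP pb0; have /(congr1 d) := pb0.
  rewrite linear0 linear_sum /= => dpb0.
  have dpb : \sum_(l < n.+1) d (iota p`_l) * b ^+ l = 0.
    rewrite -[RHS]dpb0; apply: eq_bigr => l _.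
    by rewrite coef_map derivationM_const ?derivationX_const.
  have : \sum_(l < n.+1) (iota c * d (iota p`_l) - d (iota c) * iota p`_l) * b ^+ l = 0.
    under eq_bigr do rewrite mulrBl -!mulrA.
    rewrite sumrB -!mulr_sumr dpb -[RHS](mulr0 (- d (iota c))) -[X in _ = _ * X]pb0.
    rewrite mulr0 sub0r mulNr; congr (- (_ * _)); apply: eq_bigr => l _.
    by rewrite coef_map.
  rewrite big_ord_recr /= -[p`_n]lead_coefE -/c [d (iota c) * _]mulrC subrr mul0r.
  by rewrite addr0 => ->.
have [lt_i_n|le_n_i] := ltnP i n; last first.
  have -> : i = n by apply/eqP; rewrite eqn_leq le_n_i -ltnS -size_p lt_p.
  by rewrite -[p`_n]lead_coefE.
have /(congr1 (fun g : {poly A} => iota g`_i)) := r0.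
rewrite coef_poly lt_i_n coef0 rmorph0 rmorphB !rmorphM /= !DE => /eqP.
by rewrite subr_eq0 => /eqP ->; rewrite mulrC.
Qed.
End MinimalRelation.

(** * Integrality over the constants through the coefficients of the minimal relation *)

Theorem theorem1p4 (k : fieldType) (A B : idomainAlgType k)
    (iota : {lrmorphism A -> B}) (F : set {linear B -> B})
    (k_char0 : [pchar k] =i pred0)
    (A_fg : finitely_generated_algebra A)
    (B_fg : finitely_generated_algebra B)
    (iota_inj : injective iota)
    (F_der : forall d, F d -> derivation d)
    (F_stable : forall d, F d -> forall a : A, range iota (d (iota a)))
    (B_integral : integralRange iota)
    (A_isolated : isolated_non_normal_points A) :
  forall b : B, constants F b -> integral_over (constants_sub iota F) b.
Proof.
move=> b b_const.
have [p mon_p pb] := B_integral b.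
have [|P [P0 Pb minP]] := @minimal_relation _ _ _ iota b.
  by exists p => //; apply: monic_neq0.
pose c := lead_coef P.
have c0 : tofrac c != 0 by rewrite tofrac_eq0 lead_coef_eq0.
pose T : {rmorphism A -> {fraction A}} := @tofrac A.
pose j : {rmorphism B -> {fraction B}} := @tofrac B.
have j_inj : injective j by move=> x y /eqP; rewrite tofrac_eq => /eqP.
pose G := (tofrac c)^-1 *: map_poly T P.
have mon_G : G \is monic.
  rewrite monicE lead_coefZ lead_coef_map_inj ?mulVf //.
    by move=> x y /eqP; rewrite tofrac_eq => /eqP.
have coefG i : G`_i = tofrac P`_i / tofrac c by rewrite coefZ coef_map mulrC.
have G_p : G %| map_poly T p.
  (* The pseudo-remainder still vanishes at [b] and is shorter than [P], so minimality kills it. A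
     power of [c] times [p] is then a multiple of [P], and [c] is invertible in the fraction
     field. *)
  have rem0 : p %% P = 0.
    apply: minP; first exact: ltn_modpN0.
    have := Pdiv.Idomain.divp_eq p P.
    move=> /(congr1 (fun g => (map_poly iota g).[b])) /eqP.
    rewrite rmorphD rmorphM linearZ /= hornerZ (rootP pb) mulr0 hornerD hornerM.
    by rewrite (rootP Pb) mulr0 add0r eq_sym.
  have := congr1 (map_poly T) (Pdiv.Idomain.divp_eq p P).
  rewrite rem0 addr0 rmorphM linearZ /= => pP.
  rewrite dvdpZl ?invr_eq0 //.
  rewrite -(dvdpZr (c := T (c ^+ scalp p P))).
    by rewrite pP dvdp_mull.
  by rewrite rmorphXn expf_neq0.
have int_G i : integralOver T G`_i := integral_coef_monic_factor mon_p mon_G G_p i.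
have [S1 SB SM] := constants_subring iota F_der.
have [R [psi [psi_inj psiS]]] := subring_rmorphism S1 SB SM.
have [f ftofrac] := fraction_lift (inj_comp j_inj iota_inj : injective (j \o iota)).
have fT a : f (T a) = j (iota a) := ftofrac a.
have alg_S (x : k) : constants_sub iota F x%:A.
  split; first by exists x%:A; rewrite // linearZ /= rmorph1.
  by move=> d Fd; apply: derivation_scalar; apply: F_der.
rewrite -psiS; apply: (integral_over_range psi_inj j_inj).
pose mu : {rmorphism R -> {fraction B}} := j \o psi.
have int_S x : constants_sub iota F x -> integralOver mu (j x).
  by rewrite -psiS => -[r _ <-]; apply: (integral_id mu).
(* By transitivity in the fraction field of [B], it suffices that the coefficients of [G] be
   integral over the constants of [A]. *)
apply: (@integral_root_monic _ _ mu _ (map_poly f G)).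
- exact: monic_map.
- rewrite linearZ /= rootZ ?fmorph_eq0 ?invr_eq0 //.
  have -> : map_poly f (map_poly T P) = map_poly j (map_poly iota P).
    by rewrite -!map_poly_comp; apply: eq_map_poly.
  exact: rmorph_root.
apply/integral_poly => i; rewrite coef_map /=.
have [Q [mon_Q size_Q [a _ aQ]]] := monic_ground_value A_fg (int_G i) A_isolated.
have a_const : constants_sub iota F (iota a).
  split; first by exists a.
  move=> d Fd; apply: (fraction_constant_tofrac iota_inj (F_der d Fd)).
  rewrite -/T aQ; apply: fraction_constant_horner; first exact: F_der.
  rewrite coefG; exists P`_i, c; split => //; first by rewrite lead_coef_eq0.
  exact: (minimal_relation_constant (F_der _ Fd) (F_stable _ Fd) (b_const _ Fd)).
pose lam : {rmorphism k -> {fraction B}} := j \o in_alg B.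
apply: (@integral_root_monic _ _ mu _ (map_poly lam Q - (j (iota a))%:P)).
- rewrite monicE lead_coefDl ?lead_coef_map ?(monicP mon_Q) ?rmorph1 //.
  by rewrite size_polyN size_polyC size_map_poly (leq_ltn_trans (leq_b1 _)).
- have -> : map_poly lam Q = map_poly f (map_poly (T \o in_alg A) Q).
    rewrite -map_poly_comp; apply: eq_map_poly => x /=.
    by rewrite fT linearZ /= rmorph1.
  by rewrite rootE hornerD hornerN hornerC horner_map /= -aQ fT subrr.
apply/integral_poly => l; rewrite coefB coef_map coefC; apply: integral_sub.
  exact: int_S (alg_S _).
by case: eqP => _; [apply: int_S | apply: integral0].
Qed.
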